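(* Let $w=\{(q_t,u_t)\}_{t=0}^{\infty}\in\mathcal{U}^{\omega}$ be an infinite input sequence satisfying the PE condition. Then $w$ is asymptotically persistently exciting for every input-output map $f:\mathcal{U}^{+}\to\mathbb{R}^p$ which admits an $l_1$-stable discrete-time linear switched system realization. That is, there exist maps $\Phi_{N,v}$ ($N\in\mathbb{N}$, $v\in Q^{*}$), not depending on $f$, which assign to the data $(w_N,\mathbf{O}(f,w_N))$ a matrix $M^f_N(v)=\Phi_{N,v}(w_N,\mathbf{O}(f,w_N))\in\mathbb{R}^{pD\times Dm}$, such that for every input-output map $f$ admitting an $l_1$-stable discrete-time linear switched system realization, $$\lim_{N\to\infty}M^f_N(v)=M^f(v)\quad\text{for all } v\in Q^{*}.$$
   Context: Fix positive integers $D,m,p$. Let $Q=\{1,\ldots,D\}$ (discrete modes) and $\mathcal{U}=Q\times\mathbb{R}^{m}$ (hybrid inputs). For a set $X$, $X^{*}$ is the set of finite words over $X$ (including the empty word $\epsilon$), $X^{+}=X^{*}\setminus\{\epsilon\}$, $|v|$ is the length of a word $v$. $\mathcal{U}^{\omega}$ is the set of infinite sequences of elements of $\mathcal{U}$; for $w=\{(q_t,u_t)\}_{t=0}^\infty\in\mathcal{U}^{\omega}$, $w_N=(q_0,u_0)\cdots(q_N,u_N)$. A discrete-time linear switched system $\Sigma$ of dimension $n$ is given by matrices $A_q\in\mathbb{R}^{n\times n}$, $B_q\in\mathbb{R}^{n\times m}$, $C_q\in\mathbb{R}^{p\times n}$, $q\in Q$, with dynamics $x_{t+1}=A_{q_t}x_t+B_{q_t}u_t$,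 $x_0=0$, $y_t=C_{q_t}x_t$, where $q_t\in Q$ is an arbitrary switching signal and $u_t\in\mathbb{R}^{m}$ is the continuous input. Its input-output map $y_\Sigma:\mathcal{U}^{+}\to\mathbb{R}^p$ sends $(q_0,u_0)\cdots(q_t,u_t)$ to the output $y_t$ at time $t$ generated from $x_0=0$. An input-output map is any map $f:\mathcal{U}^{+}\to\mathbb{R}^{p}$; $\Sigma$ is a realization of $f$ if $f=y_\Sigma$. For $v=\sigma_1\cdots\sigma_k\in Q^{*}$, $A_v=A_{\sigma_k}A_{\sigma_{k-1}}\cdots A_{\sigma_1}$, and $A_\epsilon$ is the identity. $\Sigma$ is $l_1$-stable if for every $x\in\mathbb{R}^n$ the series $\sum_{v\in Q^{*}}\|A_vx\|_2$ is convergent. Markov-parameters: with $e_j$ the $j$th standard unit vector of $\mathbb{R}^m$, for $q_0,q\in Q$ and $v=\sigma_1\cdots\sigma_{k}\in Q^{*}$ ($k\ge 0$), $S^f_j(q_0vq)=f\big((q_0,e_j)(\sigma_1,0)\cdots(\sigma_k,0)(q,0)\big)$, and $S^f(q_0vq)=[S^f_1(q_0vq),\ldots,S^f_m(q_0vq)]\in\mathbb{R}^{p\times m}$. The combined Markov-parameter $M^f(v)\in\mathbb{R}^{pD\times Dm}$, $v\in Q^{*}$, is the block matrix whose $p\times m$ block in block row $q$ and block column $q_0$ ($q,q_0\in Q$) is $S^f(q_0vq)$. Output time series: for $s=(q_0,u_0)\cdots(q_T,u_T)\in\mathcal{U}^{+}$, $\mathbf{O}(f,s)=\{y_t\}_{t=0}^{T}$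 with $y_t=f((q_0,u_0)\cdots(q_t,u_t))$. PE condition: $w=\{(q_t,u_t)\}_{t=0}^\infty$ satisfies the PE condition if there exist a strictly positive definite $m\times m$ matrix $\mathcal{R}$ and strictly positive numbers $\{\pi_v\}_{v\in Q^{+}}$ such that for every positive integer $j$ and every word $v\in Q^{+}$, $$\lim_{N\to\infty}\frac1N\sum_{t=0}^{N}u_{t+j}u_t^T\chi(q_tq_{t+1}\cdots q_{t+|v|-1}=v)=0,$$ $$\lim_{N\to\infty}\frac1N\sum_{t=j}^{N}u_{t-j}u_t^T\chi(q_{t-j}q_{t-j+1}\cdots q_{t-j+|v|-1}=v)=0,$$ $$\lim_{N\to\infty}\frac1N\sum_{t=0}^{N}u_{t}u_t^T\chi(q_t\cdots q_{t+|v|-1}=v)=\pi_v\mathcal{R},$$ where $\chi(A)=1$ if $A$ holds and $0$ otherwise. Asymptotic persistence of excitation: $w\in\mathcal{U}^\omega$ is asymptotically persistently exciting for $f$ if for each $N$ one can compute from $(w_N,\mathbf{O}(f,w_N))$ matrices $\{M^f_N(v)\}_{v\in Q^{*}}$ such that $\lim_{N\to\infty}M^f_N(v)=M^f(v)$ for all $v\in Q^{*}$. *)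

(* Defs.v *)
From HB Require Import structures.
From mathcomp Require Export all_boot all_order all_algebra.
From mathcomp Require Export boolp classical_sets reals ereal topology
  normedtype sequences esum.

Set Implicit Arguments.
Unset Strict Implicit.
Unset Printing Implicit Defensive.

Import Order.TTheory GRing.Theory Num.Theory.
Import numFieldNormedType.Exports.

Local Open Scope classical_set_scope.
Local Open Scope ring_scope.

(* X^+: [NEWord x s] is the nonempty word x s; X^* is [seq X]. *)
Record neword (X : Type) := NEWord { wfirst : X; wrest : seq X }.
Definition seq_of_neword (X : Type) (s : neword X) : seq X :=
  wfirst s :: wrest s.
Coercion seq_of_neword : neword >-> seq.

(* The discrete modes 1, ..., D are 'I_D, and x_t, u_t, y_t are columns. *)
Definition hinput (R : realType) (D m : nat) : Type := ('I_D * 'cV[R]_m)%type.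

Definition iomap (R : realType) (D m p : nat) : Type :=
  neword (hinput R D m) -> 'cV[R]_p.

Record switched_system (R : realType) (D m p n : nat) := SwitchedSystem {
  sysA : 'I_D -> 'M[R]_n;
  sysB : 'I_D -> 'M[R]_(n, m);
  sysC : 'I_D -> 'M[R]_(p, n)
}.

Section SwitchedSystems.
Variables (R : realType) (D m p n : nat).
Variable Sg : switched_system R D m p n.

(* The state reached from x_0 = 0 after the inputs s have been applied. *)
Definition state (s : seq (hinput R D m)) : 'cV[R]_n :=
  foldl (fun x qu => sysA Sg qu.1 *m x + sysB Sg qu.1 *m qu.2) 0 s.

(* y_t = C_{q_t} x_t, where (q_t, u_t) is the last letter of s and x_t is
   determined by the letters before it. *)
Definition io_of_system : iomap R D m p := fun s =>
  sysC Sg (last (wfirst s) (wrest s)).1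
    *m state (belast (wfirst s) (wrest s)).

(* A_{s_1 ... s_k} = A_{s_k} ... A_{s_1} *)
Definition Aword (v : seq 'I_D) : 'M[R]_n :=
  foldl (fun P q => sysA Sg q *m P) 1%:M v.

End SwitchedSystems.

(* The Euclidean norm; the library's norm `|x| on matrices is the sup norm. *)
Definition norm2 (R : realType) (n : nat) (x : 'cV[R]_n) : R :=
  Num.sqrt (\sum_(i < n) x i 0 ^+ 2).

Definition l1_stable (R : realType) (D m p n : nat)
    (Sg : switched_system R D m p n) : Prop :=
  forall x : 'cV[R]_n,
    summable [set: seq 'I_D] (fun v => (norm2 (Aword Sg v *m x))%:E).

Definition is_realization (R : realType) (D m p n : nat)
    (Sg : switched_system R D m p n) (f : iomap R D m p) : Prop :=
  f =1 io_of_system Sg.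

Definition has_l1_stable_realization (R : realType) (D m p : nat)
    (f : iomap R D m p) : Prop :=
  exists (n : nat) (Sg : switched_system R D m p n),
    l1_stable Sg /\ is_realization Sg f.

(* S^f(q0 v q), with columns S^f_j(q0 v q); delta_mx j 0 is e_j. *)
Definition markov (R : realType) (D m p : nat) (f : iomap R D m p)
    (q0 : 'I_D) (v : seq 'I_D) (q : 'I_D) : 'M[R]_(p, m) :=
  \matrix_(i < p, j < m)
    f (NEWord (q0, delta_mx j 0) [seq (s, 0) | s <- rcons v q]) i 0.

(* The dimensions \sum_(q < D) p and \sum_(q0 < D) m are p D and D m. *)
Definition combined_markov (R : realType) (D m p : nat) (f : iomap R D m p)
    (v : seq 'I_D) : 'M[R]_(\sum_(q < D) p, \sum_(q0 < D) m) :=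
  \mxblock_(q < D, q0 < D) markov f q0 v q.

(* w_N = w(0) ... w(N), of length N + 1 *)
Definition prefix_word (X : Type) (w : nat -> X) (N : nat) : neword X :=
  NEWord (w 0%N) [seq w t | t <- iota 1 N].

(* O(f, s) *)
Definition outputs (R : realType) (D m p : nat) (f : iomap R D m p)
    (s : neword (hinput R D m)) : seq 'cV[R]_p :=
  [seq f (NEWord (wfirst s) (take t (wrest s))) | t <- iota 0 (size s)].

Definition posdefmx (R : realType) (m : nat) (P : 'M[R]_m) : Prop :=
  P^T = P /\ forall x : 'cV[R]_m, x != 0 -> 0 < (x^T *m P *m x) 0 0.

(* The mode word v occurs in the sequence w at time t. *)
Definition occurs (R : realType) (D m : nat) (w : nat -> hinput R D m)
    (t : nat) (v : seq 'I_D) : bool :=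
  [seq (w (t + i)%N).1 | i <- iota 0 (size v)] == v.

(* At N = 0 the factor N^-1 is 0, which does not affect the limits. *)
Definition PE_condition (R : realType) (D m : nat)
    (w : nat -> hinput R D m) : Prop :=
  exists (Ru : 'M[R]_m) (pi_ : neword 'I_D -> R),
    [/\ posdefmx Ru,
        forall v, 0 < pi_ v &
        forall (j : nat) (v : neword 'I_D), (0 < j)%N ->
        [/\ (fun N : nat => N%:R^-1 *:
               \sum_(0 <= t < N.+1)
                 (occurs w t v)%:R *: ((w (t + j)%N).2 *m (w t).2^T))
              @ \oo --> (0 : 'M[R]_m),
            (fun N : nat => N%:R^-1 *:
               \sum_(j <= t < N.+1)
                 (occurs w (t - j) v)%:R *: ((w (t - j)%N).2 *m (w t).2^T))
              @ \oo --> (0 : 'M[R]_m) &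
            (fun N : nat => N%:R^-1 *:
               \sum_(0 <= t < N.+1)
                 (occurs w t v)%:R *: ((w t).2 *m (w t).2^T))
              @ \oo --> pi_ v *: Ru]].

(* Main.v *)
Require Import Defs.
From mathcomp Require Import cardinality fsbigop ring lra.

Set Implicit Arguments.
Unset Strict Implicit.
Unset Printing Implicit Defensive.
Import Order.TTheory GRing.Theory Num.Theory.
Import numFieldNormedType.Exports.

Local Open Scope classical_set_scope.
Local Open Scope ring_scope.

(** Let [q_t] and [u_t] be the modes and inputs of [w], and [x_t], [y_t] the
    states and outputs of an [l_1]-stable realization of [f] driven by [w]. To
    find the Markov parameter of a word [s = q0 v q], look at the times [t] at
    which [s] occurs in the mode sequence, and correlate the output at the end
    of the occurrence with the input at its beginning: take the average over
    [t <= N] of [chi(t, s) y_(t + |v| + 1) u_t^T]. By variation of constants,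
    that output is the sum of
    - [S(q0 v q) u_t];
    - fixed matrices applied to the finitely many inputs [u_(t + l)] with
      [0 < l <= |v|];
    - the fixed matrix [C_q A_v A_q0] applied to [x_t].

    The first term contributes [S(q0 v q)] times a covariance that converges to
    the invertible matrix [pi_s Ru], and the second tends to [0], both directly
    by the PE condition. Dividing by the covariance computed from the data
    therefore gives the Markov parameter in the limit, provided that the
    correlation of [x_t] with [u_t] tends to [0] ([state_input_cvg0]).

    This last point is where stability enters. The state is
    [x_t = \sum_j A_r B_q u_(t - j - 1)], where [q] is the mode at time
    [t - j - 1] and [r] the word of the [j] modes that follow. For a fixed lag
    [j], splitting the times [t] according to the finitely many words [q r]
    reduces the average to the PE condition for the words [q r s]
    ([lag_mean_cvg0]). Uniformly in [N], the average at lag [j] is at most a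
    constant times [b_j * energy], where [b_j] bounds all [A_r] with
    [|r| = j], and where the average energy of the input is bounded because it
    is at most the trace of a convergent covariance ([energy_bounded],
    [lag_mean_norm]). [l_1]-stability makes [b] summable
    ([l1_stable_length_bound]), so Tannery's theorem ([tannery0]) permits
    exchanging the limit in [N] with the sum over the lags. *)

(** * Sup norm of matrices *)

Section MatrixNorm.
Variable R : realType.

Lemma ler_mx_norm_coord m n (M : 'M[R]_(m, n)) i j : `|M i j| <= `|M|.
Proof.
by rewrite [leRHS]/Num.Def.normr /= mx_normrE (le_bigmax _ _ (i, j)).
Qed.

Lemma mx_norm_le m n (M : 'M[R]_(m, n)) (c : R) :
  0 <= c -> (forall i j, `|M i j| <= c) -> `|M| <= c.
Proof.
move=> c0 Mc; rewrite [leLHS]/Num.Def.normr /= mx_normrE.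
by rewrite bigmax_le // => -[i j] _; exact: Mc.
Qed.

Lemma ler_norm_mulmx m n k (A : 'M[R]_(m, n)) (B : 'M[R]_(n, k)) :
  `|A *m B| <= n%:R * (`|A| * `|B|).
Proof.
apply: mx_norm_le => [|i j]; first by rewrite !mulr_ge0.
rewrite mxE (le_trans (ler_norm_sum _ _ _)) //.
rewrite -[n in n%:R]card_ord mulr_natl -sumr_const ler_sum // => l _.
by rewrite normrM ler_pM // ler_mx_norm_coord.
Qed.

Lemma mx_norm_trmx m n (A : 'M[R]_(m, n)) : `|A^T| = `|A|.
Proof.
apply/eqP; rewrite eq_le; apply/andP; split; apply: mx_norm_le => // i j.
  by rewrite mxE ler_mx_norm_coord.
by rewrite -[A]trmxK mxE trmxK ler_mx_norm_coord.
Qed.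

(** The diagonal of [u u^T] carries the squares of the entries of [u], so the
    empirical second moments of a signal control its average energy. *)
Lemma sqr_mx_norm_le_outer m (u : 'cV[R]_m) :
  `|u| ^+ 2 <= \sum_i (u *m u^T) i i.
Proof.
have [u0|/mx_norm_neq0 [[i j] /= ui]] := eqVneq (mx_norm u) 0.
  rewrite [`|u|]u0 expr0n sumr_ge0 // => i _.
  by rewrite mxE sumr_ge0 // => j _; rewrite mxE -expr2 sqr_ge0.
rewrite [`|u|]ui (bigD1 i) //= ord1 real_normK ?num_real //.
rewrite [(u *m _) i i]mxE big_ord1 !mxE -expr2 lerDl sumr_ge0 // => k _.
by rewrite mxE big_ord1 mxE -expr2 sqr_ge0.
Qed.

End MatrixNorm.

(** * Limits of matrices and series *)

Section Limits.
Variable R : realType.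

Lemma cvg_sumr (V : normedModType R) (T I : Type) (F : set_system T)
    {FF : Filter F} (r : seq I) (P : pred I) (f : I -> T -> V) (l : I -> V) :
  (forall i, P i -> f i x @[x --> F] --> l i) ->
  (\sum_(i <- r | P i) f i x) @[x --> F] --> \sum_(i <- r | P i) l i.
Proof.
move=> fl; elim: r => [|i r IH].
  by under eq_fun do rewrite big_nil; rewrite big_nil; exact: cvg_cst.
under eq_fun do rewrite big_cons; rewrite big_cons.
by case: ifP => // Pi; apply: cvgD => //; exact: fl.
Qed.

Lemma cvg_prodr (T I : Type) (F : set_system T) {FF : Filter F}
    (r : seq I) (f : I -> T -> R) (l : I -> R) :
  (forall i, f i x @[x --> F] --> l i) ->
  (\prod_(i <- r) f i x) @[x --> F] --> \prod_(i <- r) l i.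
Proof.
move=> fl; elim: r => [|i r IH].
  by under eq_fun do rewrite big_nil; rewrite big_nil; exact: cvg_cst.
under eq_fun do rewrite big_cons; rewrite big_cons.
by apply: cvgM => //; exact: fl.
Qed.

Lemma cvg_mxP (T : Type) (F : set_system T) {FF : Filter F} m n
    (M : T -> 'M[R]_(m, n)) (L : 'M[R]_(m, n)) :
  M x @[x --> F] --> L <-> forall i j, M x i j @[x --> F] --> L i j.
Proof.
split=> [ML i j|ML].
  exact: (cvg_comp _ _ ML (@coord_continuous _ _ _ i j L)).
apply/cvgrPdist_le => e e0; near=> x.
apply: mx_norm_le => [|i j]; first exact: ltW.
rewrite !mxE; move: i j; near: x.
apply: filter_forall => i; apply: filter_forall => j.
exact: ((cvgrPdist_le _ _).1 (ML i j)).
Unshelve. all: by end_near. Qed.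

Lemma cvg_mulmx (T : Type) (F : set_system T) {FF : Filter F} m n k
    (M : T -> 'M[R]_(m, n)) (N : T -> 'M[R]_(n, k))
    (L : 'M[R]_(m, n)) (K : 'M[R]_(n, k)) :
  M x @[x --> F] --> L -> N x @[x --> F] --> K ->
  (M x *m N x) @[x --> F] --> L *m K.
Proof.
move=> /cvg_mxP ML /cvg_mxP NK; apply/cvg_mxP => i j.
under eq_fun do rewrite mxE; rewrite mxE.
by apply: cvg_sumr => l _; apply: cvgM.
Qed.

Lemma cvg_det (T : Type) (F : set_system T) {FF : Filter F} n
    (M : T -> 'M[R]_n) (L : 'M[R]_n) :
  M x @[x --> F] --> L -> \det (M x) @[x --> F] --> \det L.
Proof.
move=> /cvg_mxP ML; rewrite /determinant; apply: cvg_sumr => s _.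
by apply: cvgM; [exact: cvg_cst | exact: cvg_prodr].
Qed.

(** Inversion is continuous at invertible matrices, by Cramer's rule. *)
Lemma cvg_invmx (T : Type) (F : set_system T) {FF : Filter F} n
    (M : T -> 'M[R]_n) (L : 'M[R]_n) :
  L \in unitmx -> M x @[x --> F] --> L ->
  invmx (M x) @[x --> F] --> invmx L.
Proof.
move=> uL ML; have detL0 : \det L != 0 by rewrite -unitfE -unitmxE.
have detML : \det (M x) @[x --> F] --> \det L by exact: cvg_det.
have adjML : \adj (M x) @[x --> F] --> \adj L.
  apply/cvg_mxP => i j; under eq_fun do rewrite mxE; rewrite mxE.
  apply: cvgM; first exact: cvg_cst.
  apply: cvg_det; apply/cvg_mxP => a b; under eq_fun do rewrite !mxE.
  by rewrite !mxE; exact: ((cvg_mxP _ _).1 ML).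
have main : (\det (M x))^-1 *: \adj (M x) @[x --> F]
    --> (\det L)^-1 *: \adj L.
  by apply: cvgZ => //; exact: cvgV.
rewrite [invmx L]/invmx uL; apply: cvg_trans main; apply: near_eq_cvg.
near=> x; rewrite /invmx; have -> // : M x \in unitmx.
rewrite unitmxE unitfE; near: x.
exact: (cvgr_neq0 (\det L)).
Unshelve. all: by end_near. Qed.

(** Tannery's theorem, the dominated convergence theorem for series. *)
Lemma tannery0 (V : normedModType R) (Y : nat -> nat -> V) (b : nat -> R) :
  cvgn (series b) -> (forall j N, `|Y j N| <= b j) ->
  (forall j, Y j N @[N --> \oo] --> 0) ->
  (\sum_(0 <= j < N.+1) Y j N) @[N --> \oo] --> 0.
Proof.
move=> cb Yb Y0; apply/cvgr0Pnorm_le => e e0.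
have e20 : 0 < e / 2 by rewrite divr_gt0.
(* From [J] on, the dominating series adds up to at most [e / 2]. *)
have [J _ tail] : \forall J \near \oo, forall N, (J <= N)%N ->
    \sum_(J <= j < N) b j <= e / 2.
  have b0 j : 0 <= b j by exact: le_trans (Yb j 0%N).
  have nd : nondecreasing_seq (series b).
    by apply: nondecreasing_series => j _ _; exact: b0.
  have /cvgrPdist_le/(_ (e / 2) e20) := cb.
  apply: filterS => J lJ N JN; rewrite -(sub_series_geq _ JN).
  apply: le_trans (le_trans (ler_norm _) lJ); rewrite lerD2r.
  exact: nondecreasing_cvgn_le.
have head : (\sum_(0 <= j < J) Y j N) @[N --> \oo] --> (0 : V).
  have := @cvg_sumr V _ _ \oo _ (index_iota 0 J) xpredT Y (fun=> 0)
    (fun j _ => Y0 j).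
  by rewrite big1_eq; apply.
near=> N.
have JN : (J <= N.+1)%N by near: N; exists J => // N /= /leqW.
rewrite (big_cat_nat (leq0n J) JN) /= (le_trans (ler_normD _ _)) //.
rewrite [leRHS]splitr.
apply: lerD.
  by near: N; move/cvgr0Pnorm_le : head; apply.
apply: le_trans (tail J (leqnn _) _ JN).
by rewrite (le_trans (ler_norm_sum _ _ _)) // ler_sum.
Unshelve. all: by end_near. Qed.

End Limits.

(** * Summability of the matrix products of a stable system *)

Section Stability.
Variables (R : realType) (D m p n : nat).
Implicit Type Sg : switched_system R D m p n.

Lemma norm2_coord_le (x : 'cV[R]_n) i : `|x i 0| <= norm2 x.
Proof.
rewrite -sqrtr_sqr ler_sqrt ?sumr_ge0 //; last by move=> *; rewrite sqr_ge0.
by rewrite (bigD1 i) //= lerDl sumr_ge0 // => j _; rewrite sqr_ge0.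
Qed.

(** The series over all words is regrouped by length; applied to the standard
    basis vectors, stability controls every column of the matrix product of a
    word. The bound depends on the length of the word only, which is what a
    series over the lags can use. *)
Lemma l1_stable_length_bound Sg : l1_stable Sg ->
  exists b : nat -> R,
    cvgn (series b) /\ forall v, `|Aword Sg v| <= b (size v).
Proof.
move=> st.
pose g (i : 'I_n) (v : seq 'I_D) : \bar R :=
  (norm2 (Aword Sg v *m delta_mx i 0))%:E.
pose W k := [set v : seq 'I_D | size v = k].
have g0 i v : (0 <= g i v)%E by rewrite lee_fin sqrtr_ge0.
have esumT i : (\esum_(v in [set: seq 'I_D]) g i v < +oo)%E.
  have := st (delta_mx i 0); rewrite /summable (eq_esum (b := g i)) //.
  by move=> v _; exact: gee0_abs (g0 i v).
pose h (i : 'I_n) k : \bar R := (\esum_(v in W k) g i v)%E.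
have h0 i k : (0 <= h i k)%E by apply: esum_ge0.
have sumh i : summable [set: nat] (h i).
  rewrite /summable (eq_esum (b := h i)); last first.
    by move=> k _; exact: gee0_abs (h0 i k).
  rewrite -(esum_bigcupT W) //; last first.
    by move=> j k _ _ [v [/= <- <-]].
  suff -> : \bigcup_k W k = [set: seq 'I_D] by [].
  by apply/seteqP; split=> // v _; exists (size v).
pose b k : R := \sum_(i < n) fine (h i k).
exists b; split.
  have cv i : cvgn (series (fun k => fine (h i k))).
    apply: (@summable_cvg R xpredT) => //.
    have -> : (fun x => is_true (xpredT x)) = [set: nat].
      by apply/funext => x; apply/propext; split.
    exact: sumh.
  have -> : series b =
      fun N => \sum_(i < n) series (fun k => fine (h i k)) N.
    by apply/funext => N; rewrite /series /= exchange_big.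
  apply: (cvgP (\sum_(i < n) limn (series (fun k => fine (h i k))))).
  by apply: cvg_sumr => i _; exact: cv.
move=> v; have fh i : h i (size v) \is a fin_num.
  rewrite ge0_fin_numE // -[ltLHS]gee0_abs //.
  exact: summable_pinfty (sumh i) _ I.
have gh i : norm2 (Aword Sg v *m delta_mx i 0) <= fine (h i (size v)).
  rewrite -lee_fin fineK //.
  apply: esum_ge; exists [set v].
    by split; [exact: finite_set1 | move=> _ ->].
  by rewrite fsbig_set1.
apply: mx_norm_le => [|i j].
  by apply: sumr_ge0 => i _; exact: fine_ge0.
rewrite /b (bigD1 j) //= -[leLHS]addr0 lerD //; last first.
  by apply: sumr_ge0 => k _; exact: fine_ge0.
apply: le_trans (gh j); rewrite -colE.
by have := norm2_coord_le (col j (Aword Sg v)) i; rewrite mxE.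
Qed.

End Stability.

(** * Trajectories and outputs *)

Section Trajectories.
Variables (R : realType) (D m p n : nat).
Variables (Sg : switched_system R D m p n) (w : nat -> hinput R D m).

Definition modes t k : seq 'I_D := [seq (w (t + i)%N).1 | i <- iota 0 k].

Definition trajectory t : 'cV[R]_n := state Sg [seq w i | i <- iota 0 t].

Lemma size_modes t k : size (modes t k) = k.
Proof. by rewrite size_map size_iota. Qed.

Lemma modesS t k : modes t k.+1 = (w t).1 :: modes t.+1 k.
Proof.
rewrite /modes /= addn0 (iotaDl 1 0) -map_comp.
by congr (_ :: _); apply: eq_map => i /=; rewrite addnA addn1.
Qed.

Lemma modes_rcons t k : modes t k.+1 = rcons (modes t k) (w (t + k)%N).1.
Proof. by rewrite /modes -[k.+1]addn1 iotaD map_cat cats1. Qed.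

Lemma modes_cat t k l : modes t (k + l) = modes t k ++ modes (t + k) l.
Proof.
elim: k t => [|k IH] t; first by rewrite addn0.
by rewrite addSn !modesS IH addSnnS.
Qed.

Lemma drop_modes t k l : drop l (modes t k) = modes (t + l) (k - l).
Proof.
have [lk|kl] := leqP l k.
  by rewrite -{1}(subnKC lk) modes_cat drop_size_cat // size_modes.
rewrite drop_oversize ?size_modes 1?ltnW //.
by rewrite (eqP (ltnW kl)).
Qed.

Lemma nth_modes q t k l : (l < k)%N -> nth q (modes t k) l = (w (t + l)%N).1.
Proof. by move=> lk; rewrite (nth_map 0%N) ?size_iota // nth_iota. Qed.

Lemma occursE t v : occurs w t v = (modes t (size v) == v).
Proof. by []. Qed.

Lemma occurs_cat t v1 v2 :
  occurs w t (v1 ++ v2) = occurs w t v1 && occurs w (t + size v1) v2.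
Proof. by rewrite !occursE size_cat modes_cat eqseq_cat ?size_modes. Qed.

Lemma Aword_rcons v q : Aword Sg (rcons v q) = sysA Sg q *m Aword Sg v.
Proof. by rewrite /Aword foldl_rcons. Qed.

Lemma Aword_cons q v : Aword Sg (q :: v) = Aword Sg v *m sysA Sg q.
Proof.
elim/last_ind: v => [|v r IH]; first by rewrite /Aword /= mulmx1 mul1mx.
by rewrite -rcons_cons !Aword_rcons IH mulmxA.
Qed.

Lemma trajectory0 : trajectory 0 = 0.
Proof. by []. Qed.

Lemma trajectoryS t : trajectory t.+1 =
  sysA Sg (w t).1 *m trajectory t + sysB Sg (w t).1 *m (w t).2.
Proof.
by rewrite /trajectory -[t.+1]addn1 iotaD map_cat cats1 /state foldl_rcons.
Qed.

(** Variation of constants: the input at time [t + l] is transported by the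
    modes met strictly after that time, whence the shift in [drop l.+1]. *)
Lemma trajectoryD t k : trajectory (t + k) =
  Aword Sg (modes t k) *m trajectory t +
  \sum_(l < k) Aword Sg (drop l.+1 (modes t k)) *m
    (sysB Sg (w (t + l)%N).1 *m (w (t + l)%N).2).
Proof.
elim: k => [|k IH]; first by rewrite big_ord0 addr0 addn0 /Aword mul1mx.
rewrite addnS trajectoryS IH modes_rcons Aword_rcons mulmxDr mulmxA -addrA.
congr (_ + _); rewrite big_ord_recr /= -modes_rcons drop_oversize; last first.
  by rewrite size_modes.
rewrite [Aword Sg [::]]/Aword mul1mx mulmx_sumr; congr (_ + _).
apply: eq_bigr => l _.
by rewrite modes_rcons drop_rcons ?size_modes // Aword_rcons mulmxA.
Qed.

(** Variation of constants from the zero initial state, indexed by the lag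
    between the input and the state rather than by absolute time. *)
Lemma trajectory_lags t : trajectory t =
  \sum_(j < t) Aword Sg (modes (t - j) j) *m
    (sysB Sg (w (t - j.+1)%N).1 *m (w (t - j.+1)%N).2).
Proof.
have := trajectoryD 0 t; rewrite trajectory0 mulmx0 !add0r => ->.
rewrite (reindex_inj rev_ord_inj) /=; apply: eq_bigr => j _.
by rewrite subnSK // drop_modes subKn // ltnW.
Qed.

Lemma prefix_wordE t :
  prefix_word w t = rcons [seq w i | i <- iota 0 t] (w t) :> seq _.
Proof. by rewrite -map_rcons -[rcons _ _]cats1 -(iotaD 0 t 1) addn1. Qed.

Lemma io_of_prefix t :
  io_of_system Sg (prefix_word w t) = sysC Sg (w t).1 *m trajectory t.
Proof.
have := prefix_wordE t.
rewrite /seq_of_neword lastI => /rcons_inj [e1 e2].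
by rewrite /io_of_system e1 e2.
Qed.

Lemma nth_prefix_word x0 N t : (t <= N)%N -> nth x0 (prefix_word w N) t = w t.
Proof.
case: t => [//|t] tN /=.
by rewrite (nth_map 0%N) ?size_iota // nth_iota.
Qed.

Lemma size_prefix_word N : size (prefix_word w N) = N.+1.
Proof. by rewrite /= size_map size_iota. Qed.

Lemma nth_outputs (f : iomap R D m p) N t : (t <= N)%N ->
  nth 0 (outputs f (prefix_word w N)) t = f (prefix_word w t).
Proof.
move=> tN; rewrite (nth_map 0%N) ?size_iota ?size_prefix_word //.
rewrite nth_iota ?size_prefix_word //=; congr (f (NEWord _ _)).
by rewrite -map_take take_iota (minn_idPl tN).
Qed.

End Trajectories.

(** * Markov parameters of a realization *)

Section MarkovParameters.
Variables (R : realType) (D m p n : nat).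
Implicit Type Sg : switched_system R D m p n.

Lemma markov_realization Sg (f : iomap R D m p) q0 v q :
  is_realization Sg f ->
  markov f q0 v q = sysC Sg q *m (Aword Sg v *m sysB Sg q0).
Proof.
move=> fS; have free (x : 'cV[R]_n) :
    foldl (fun x qu => sysA Sg qu.1 *m x + sysB Sg qu.1 *m qu.2) x
      [seq (s, 0) | s <- v] = Aword Sg v *m x.
  elim: v x => [|r v IH] x /=; first by rewrite /Aword /= mul1mx.
  by rewrite IH Aword_cons mulmx0 addr0 mulmxA.
apply/matrixP => i j; rewrite mxE fS /io_of_system /= map_rcons last_rcons.
rewrite belast_rcons /state /= mulmx0 add0r free !mulmxA -colE.
by rewrite [LHS]mxE.
Qed.

End MarkovParameters.

(** * Decorrelation of the state and the current input *)

Section StateInputCorrelation.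
Variables (R : realType) (D m p n : nat) (w : nat -> hinput R D m).
Implicit Type Sg : switched_system R D m p n.

(** The part of [x_t u_t^T] that is due to the input at time [t - j - 1]. *)
Definition lag_term Sg j t : 'M[R]_(n, m) :=
  Aword Sg (modes w (t - j) j) *m
    (sysB Sg (w (t - j.+1)%N).1 *m (w (t - j.+1)%N).2) *m (w t).2^T.

Definition lag_mean Sg v j N : 'M[R]_(n, m) :=
  N%:R^-1 *: \sum_(j.+1 <= t < N.+1) (occurs w t v)%:R *: lag_term Sg j t.

(** Exactly one mode is active at each time, so the covariance of the whole
    input is the sum over the modes of the covariances in the third PE limit
    and converges; it dominates the average energy. *)
Lemma energy_bounded : PE_condition w ->
  exists K : R, forall N : nat,
    N%:R^-1 * \sum_(0 <= t < N.+1) `|(w t).2| ^+ 2 <= K.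
Proof.
case=> [Ru [pi_ [_ _ PE]]].
pose S N : 'M[R]_m := N%:R^-1 *: \sum_(0 <= t < N.+1) (w t).2 *m (w t).2^T.
have cS : cvgn S.
  have -> : S = fun N => \sum_(q < D) N%:R^-1 *: \sum_(0 <= t < N.+1)
      (occurs w t [:: q])%:R *: ((w t).2 *m (w t).2^T).
    apply/funext => N; rewrite -scaler_sumr exchange_big /=; congr (_ *: _).
    apply: eq_bigr => t _; rewrite -scaler_suml (bigD1 (w t).1) //= big1.
      by rewrite occursE modesS eqxx addr0 scale1r.
    move=> q /negPf qt; rewrite occursE /= modesS eq_sym eqseq_cons qt.
    by [].
  apply: (cvgP (\sum_(q < D) pi_ (NEWord q [::]) *: Ru)).
  by apply: cvg_sumr => q _; case: (PE 1%N (NEWord q [::]) isT).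
have /ex_bound [|K SK] := cvg_seq_bounded cS.
  exact: (@globally_properfilter _ _ 0%N).
exists (m%:R * K) => N.
have trS : N%:R^-1 * \sum_(0 <= t < N.+1) `|(w t).2| ^+ 2 <= \sum_i S N i i.
  under [leRHS]eq_bigr do rewrite mxE summxE.
  rewrite -mulr_sumr ler_wpM2l // exchange_big ler_sum // => t _.
  exact: sqr_mx_norm_le_outer.
apply: le_trans trS _; rewrite -[m in m%:R]card_ord mulr_natl -sumr_const.
apply: ler_sum => i _; apply: le_trans (ler_norm _) _.
by apply: le_trans (ler_mx_norm_coord _ _ _) _; apply: SK.
Qed.

(** A lag [j] contributes at the times [t > j] only. With this range, the second
    PE limit applies to each [lag_mean] as it stands. *)
Lemma state_input_mean_lags Sg v N :
  N%:R^-1 *: \sum_(0 <= t < N.+1)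
    (occurs w t v)%:R *: (trajectory Sg w t *m (w t).2^T) =
  \sum_(0 <= j < N.+1) lag_mean Sg v j N.
Proof.
rewrite -scaler_sumr; congr (_ *: _).
transitivity (\sum_(0 <= t < N.+1) \sum_(0 <= j < N.+1 | (j < t)%N)
    (occurs w t v)%:R *: lag_term Sg j t).
  apply: eq_big_nat => t /andP [_ tN]; rewrite trajectory_lags mulmx_suml.
  by rewrite scaler_sumr -(big_nat_widen _ _ _ xpredT) 1?ltnW // big_mkord.
rewrite (exchange_big_dep_nat xpredT) //=; apply: eq_big_nat => j /andP [_ jN].
by rewrite [RHS](big_nat_widenl _ 0) //; apply: eq_bigl => t; rewrite andbT.
Qed.

(** The product of two input norms is bounded by the sum of their squares, so
    that its time average is controlled by the energy whatever the lag. *)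
Lemma lag_term_norm Sg (b : nat -> R) j t :
  (forall v, `|Aword Sg v| <= b (size v)) ->
  `|lag_term Sg j t| <= n%:R * m%:R * (\sum_q `|sysB Sg q|) * b j *
    (`|(w (t - j.+1)%N).2| ^+ 2 + `|(w t).2| ^+ 2).
Proof.
move=> Ab; set u := (w (t - j.+1)%N).2; set u' := (w t).2.
set q := (w (t - j.+1)%N).1; set beta := \sum_q _.
have b0 : 0 <= b j.
  by rewrite -(size_modes w 0 j); apply: le_trans (Ab _).
have Bq : `|sysB Sg q| <= beta.
  by rewrite /beta (bigD1 q) //= lerDl sumr_ge0.
have A_b : `|Aword Sg (modes w (t - j) j)| <= b j.
  by have := Ab (modes w (t - j) j); rewrite size_modes.
apply: le_trans (ler_norm_mulmx _ _) _; rewrite mul1r mx_norm_trmx.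
have uu : `|u| * `|u'| <= `|u| ^+ 2 + `|u'| ^+ 2.
  have := sqr_ge0 (`|u| - `|u'|); have := sqr_ge0 (`|u| + `|u'|).
  by nra.
have ABu : `|Aword Sg (modes w (t - j) j) *m (sysB Sg q *m u)| <=
    n%:R * m%:R * beta * b j * `|u|.
  have -> : n%:R * m%:R * beta * b j * `|u| =
      n%:R * (b j * (m%:R * (beta * `|u|))) by ring.
  apply: le_trans (ler_norm_mulmx _ _) _; rewrite ler_wpM2l // ler_pM //.
  apply: le_trans (ler_norm_mulmx _ _) _; rewrite ler_wpM2l //.
  exact: ler_wpM2r.
apply: le_trans (ler_wpM2r _ ABu) _ => //.
by rewrite -[leLHS]mulrA ler_wpM2l // !mulr_ge0 // sumr_ge0.
Qed.

Lemma lag_mean_norm Sg v (b : nat -> R) (K : R) j N :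
  (forall v, `|Aword Sg v| <= b (size v)) ->
  N%:R^-1 * \sum_(0 <= t < N.+1) `|(w t).2| ^+ 2 <= K ->
  `|lag_mean Sg v j N| <=
     (n%:R * m%:R * (\sum_q `|sysB Sg q|) * (K + K)) * b j.
Proof.
move=> Ab NK; set c := n%:R * m%:R * _.
have b0 k : 0 <= b k.
  by rewrite -(size_modes w 0 k); apply: le_trans (Ab _).
have c0 : 0 <= c * b j.
  by rewrite !mulr_ge0 // sumr_ge0.
rewrite normrZ ger0_norm ?invr_ge0 //.
have sq0 t : 0 <= `|(w t).2| ^+ 2 by rewrite exprn_ge0.
(* The inputs of the past, shifted back, are among those up to [N]. *)
have past : \sum_(j.+1 <= t < N.+1) `|(w (t - j.+1)%N).2| ^+ 2 <=
    \sum_(0 <= t < N.+1) `|(w t).2| ^+ 2.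
  have [jN|Nj] := leqP j.+1 N.+1; last by rewrite big_geq ?sumr_ge0 1?ltnW.
  rewrite -{1}(add0n j.+1) big_addn.
  rewrite [leRHS](big_cat_nat (n := (N.+1 - j.+1)%N)) ?leq_subr //=.
  under eq_bigr do rewrite addnK.
  by rewrite lerDl sumr_ge0.
have present : \sum_(j.+1 <= t < N.+1) `|(w t).2| ^+ 2 <=
    \sum_(0 <= t < N.+1) `|(w t).2| ^+ 2.
  have [jN|Nj] := leqP j.+1 N.+1; last by rewrite big_geq ?sumr_ge0 1?ltnW.
  by rewrite [leRHS](big_cat_nat (leq0n j.+1) jN) /= lerDr sumr_ge0.
have term t : `|(occurs w t v)%:R *: lag_term Sg j t| <=
    c * b j * (`|(w (t - j.+1)%N).2| ^+ 2 + `|(w t).2| ^+ 2).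
  rewrite normrZ; apply: le_trans (lag_term_norm _ _ Ab).
  by rewrite ger0_norm // ler_piMl //; case: occurs.
have sum_le : `|\sum_(j.+1 <= t < N.+1) (occurs w t v)%:R *: lag_term Sg j t|
    <= c * b j * (2 * \sum_(0 <= t < N.+1) `|(w t).2| ^+ 2).
  apply: le_trans (ler_norm_sum _ _ _) _.
  apply: le_trans (ler_sum _ (fun t _ => term t)) _.
  rewrite -mulr_sumr ler_wpM2l // big_split /= mulrDl mul1r.
  exact: lerD.
have -> : c * (K + K) * b j = c * b j * (2 * K).
  by rewrite mulrDl mul1r mulrAC.
apply: (@le_trans _ _ (N%:R^-1 * (c * b j *
    (2 * \sum_(0 <= t < N.+1) `|(w t).2| ^+ 2)))).
  by rewrite ler_wpM2l ?invr_ge0.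
by rewrite mulrCA [N%:R^-1 * _]mulrCA !ler_wpM2l.
Qed.

(** The matrix in [lag_term] depends only on the word of the [j + 1] modes that
    precede time [t]. There are finitely many such words [r], and an occurrence
    of [r] followed by one of [v] is an occurrence of [r ++ v]. *)
Lemma lag_mean_cvg0 Sg v j : PE_condition w ->
  lag_mean Sg v j N @[N --> \oo] --> (0 : 'M[R]_(n, m)).
Proof.
case=> [Ru [pi_ [_ _ PE]]].
pose Z (r : j.+1.-tuple 'I_D) N : 'M[R]_m := N%:R^-1 *:
  \sum_(j.+1 <= t < N.+1) (occurs w (t - j.+1) (r ++ v))%:R *:
    ((w (t - j.+1)%N).2 *m (w t).2^T).
pose G (r : j.+1.-tuple 'I_D) := Aword Sg (behead r) *m sysB Sg (thead r).
have -> : lag_mean Sg v j = fun N => \sum_r G r *m Z r N.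
  apply/funext => N; rewrite /lag_mean.
  under [RHS]eq_bigr do rewrite -scalemxAr mulmx_sumr.
  rewrite -scaler_sumr exchange_big /=; congr (_ *: _).
  apply: eq_big_nat => t /andP [jt _].
  (* Among all words, only the one actually read before [t] contributes. *)
  have [r0 r0E] : exists r : j.+1.-tuple 'I_D, tval r = modes w (t - j.+1) j.+1.
    have sz : size (modes w (t - j.+1) j.+1) == j.+1 by rewrite size_modes.
    by exists (Tuple sz).
  rewrite (bigD1 r0) //= big1 ?addr0 => [|r rr0].
    rewrite occurs_cat size_tuple subnK // [occurs _ _ r0]occursE size_tuple.
    rewrite r0E eqxx andTb.
    rewrite -scalemxAr /G /thead (tnth_nth (w 0%N).1) r0E; congr (_ *: _).
    by rewrite modesS /lag_term /= subnSK // !mulmxA.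
  rewrite occurs_cat occursE size_tuple -r0E.
  have /negPf -> : r0 != r :> seq _ by rewrite eq_sym.
  by rewrite scale0r mulmx0.
have Z0 r : Z r N @[N --> \oo] --> (0 : 'M[R]_m).
  have [_ + _] := PE j.+1 (NEWord (thead r) (behead r ++ v)) isT.
  by rewrite /Z [in r ++ v](tuple_eta r).
have := @cvg_sumr R _ _ _ \oo _ (index_enum _) xpredT
  (fun r N => G r *m Z r N : 'M[R]_(n, m)) (fun=> (0 : 'M[R]_(n, m))).
rewrite big1_eq; apply=> r _; rewrite -(mulmx0 _ (G r)).
by apply: cvg_mulmx => //; exact: cvg_cst.
Qed.

(** Although the state accumulates all past inputs, it is asymptotically
    uncorrelated with the current one: the lags do so one by one, and stability
    makes their sum uniformly convergent. *)
Lemma state_input_cvg0 Sg v : PE_condition w -> l1_stable Sg ->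
  (N%:R^-1 *: \sum_(0 <= t < N.+1)
    (occurs w t v)%:R *: (trajectory Sg w t *m (w t).2^T))
    @[N --> \oo] --> (0 : 'M[R]_(n, m)).
Proof.
move=> PE /l1_stable_length_bound [b [cb Ab]].
have [K NK] := energy_bounded PE.
under eq_fun do rewrite state_input_mean_lags.
apply: (tannery0 (b := fun j =>
  (n%:R * m%:R * (\sum_q `|sysB Sg q|) * (K + K)) * b j)).
- exact: is_cvg_seriesZ.
- by move=> j N; apply: lag_mean_norm.
- by move=> j; apply: lag_mean_cvg0.
Qed.

End StateInputCorrelation.

(** * Estimation of the Markov parameters from the data *)

Section Estimation.
Variables (R : realType) (D m p : nat).

(** The correlation of the outputs at the end of the occurrences of [v] with the
    inputs at their beginning, normalized by the covariance of these inputs.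
    Once the data are at least as long as [v], the range of [t] is the largest
    for which the window [t, ..., t + |v| - 1] lies within them. *)
Definition markov_estimate (s : neword (hinput R D m)) (ys : seq 'cV[R]_p)
    (v : seq 'I_D) : 'M[R]_(p, m) :=
  let z := nth (wfirst s) s in
  let M := (size s - size v)%N in
  (M%:R^-1 *: \sum_(0 <= t < M.+1) (occurs z t v)%:R *:
    (nth 0 ys (t + (size v).-1) *m (z t).2^T)) *m
  invmx (M%:R^-1 *: \sum_(0 <= t < M.+1) (occurs z t v)%:R *:
    ((z t).2 *m (z t).2^T)).

Lemma markov_estimate_prefix (w : nat -> hinput R D m) (f : iomap R D m p)
    N q0 v : (size v <= N)%N ->
  let W := q0 :: v in let M := (N - size v)%N in
  markov_estimate (prefix_word w N) (outputs f (prefix_word w N)) W =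
  (M%:R^-1 *: \sum_(0 <= t < M.+1) (occurs w t W)%:R *:
    (f (prefix_word w (t + size v)) *m (w t).2^T)) *m
  invmx (M%:R^-1 *: \sum_(0 <= t < M.+1) (occurs w t W)%:R *:
    ((w t).2 *m (w t).2^T)).
Proof.
move=> vN W M; rewrite /markov_estimate size_prefix_word subSS -/M.
have inN t : (0 <= t < M.+1)%N -> (t + size v <= N)%N.
  by move=> /andP [_]; rewrite ltnS -(leq_add2r (size v)) subnK.
set z := nth _ _.
have zE t : (t <= N)%N -> z t = w t by exact: nth_prefix_word.
have occ t : (0 <= t < M.+1)%N -> occurs z t W = occurs w t W.
  move=> /inN tv; rewrite /occurs; congr (_ == _).
  apply/eq_in_map => i; rewrite mem_iota add0n ltnS => /andP [_ iv].
  by rewrite zE // (leq_trans _ tv) // leq_add2l.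
congr ((_ *: _) *m invmx (_ *: _)); apply: eq_big_nat => t tM.
  rewrite occ // nth_outputs ?inN // zE //.
  exact: leq_trans (leq_addr _ _) (inN t tM).
by rewrite occ // zE // (leq_trans (leq_addr _ _) (inN t tM)).
Qed.

(** A vector in the kernel of [P] makes the quadratic form of [P] vanish. *)
Lemma posdefmx_unit (P : 'M[R]_m) : posdefmx P -> P \in unitmx.
Proof.
case=> sP posP; rewrite -row_free_unit -kermx_eq0.
apply/rowV0P => x /sub_kermxP xP; apply/eqP; apply: contraT => x0.
have := posP x^T; rewrite trmxK xP mul0mx mxE ltxx.
by apply; rewrite -trmx0 (inj_eq trmx_inj).
Qed.

(** Of all the inputs that enter the output at the end of an occurrence of
    [q0 v q], the input at its beginning is asymptotically uncorrelated with all
    but itself, and its own coefficient in the variation of constants formula is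
    the Markov parameter. *)
Lemma output_input_cvg n (Sg : switched_system R D m p n)
    (w : nat -> hinput R D m) (f : iomap R D m p) q0 v q (C : 'M[R]_m) :
  PE_condition w -> l1_stable Sg -> is_realization Sg f ->
  (N%:R^-1 *: \sum_(0 <= t < N.+1) (occurs w t (q0 :: rcons v q))%:R *:
    ((w t).2 *m (w t).2^T)) @[N --> \oo] --> C ->
  (N%:R^-1 *: \sum_(0 <= t < N.+1) (occurs w t (q0 :: rcons v q))%:R *:
    (f (prefix_word w (t + (size v).+1)) *m (w t).2^T)) @[N --> \oo]
    --> markov f q0 v q *m C.
Proof.
move=> PE st fS WC; have [Ru [pi_ [_ _ cross]]] := PE.
set W := q0 :: rcons v q.
pose G l : 'M[R]_(n, m) :=
  Aword Sg (drop l v) *m sysB Sg (nth q0 (q0 :: v) l).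
pose U l N : 'M[R]_m := N%:R^-1 *: \sum_(0 <= t < N.+1)
  (occurs w t W)%:R *: ((w (t + l)%N).2 *m (w t).2^T).
pose X N : 'M[R]_(n, m) := N%:R^-1 *: \sum_(0 <= t < N.+1)
  (occurs w t W)%:R *: (trajectory Sg w t *m (w t).2^T).
have split_output t : occurs w t W -> f (prefix_word w (t + (size v).+1)) =
    sysC Sg q *m (Aword Sg (q0 :: v) *m trajectory Sg w t +
      \sum_(l < (size v).+1) G l *m (w (t + l)%N).2).
  rewrite occursE /W -rcons_cons size_rcons modes_rcons eqseq_rcons.
  move=> /andP [/eqP modesE /eqP qE].
  rewrite fS io_of_prefix qE trajectoryD modesE; congr (_ *m (_ + _)).
  apply: eq_bigr => l _; rewrite /G mulmxA /=; congr (_ *m sysB _ _ *m _).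
  by rewrite -(nth_modes w q0 t (ltn_ord l)) modesE.
have XU N : N%:R^-1 *: \sum_(0 <= t < N.+1) (occurs w t W)%:R *:
      (f (prefix_word w (t + (size v).+1)) *m (w t).2^T) =
    sysC Sg q *m (Aword Sg (q0 :: v) *m X N +
      \sum_(l < (size v).+1) G l *m U l N).
  have -> : \sum_(l < (size v).+1) G l *m U l N =
      N%:R^-1 *: \sum_(0 <= t < N.+1) (occurs w t W)%:R *:
        \sum_(l < (size v).+1) G l *m ((w (t + l)%N).2 *m (w t).2^T).
    under eq_bigr do rewrite /U -scalemxAr mulmx_sumr.
    rewrite -scaler_sumr exchange_big; congr (_ *: _); apply: eq_bigr => t _.
    by rewrite scaler_sumr; apply: eq_bigr => l _; rewrite -scalemxAr.
  rewrite -scalemxAr mulmx_sumr -scalerDr -scalemxAr -big_split mulmx_sumr.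
  congr (_ *: _); apply: eq_bigr => t _ /=.
  rewrite -scalemxAr -scalerDr -scalemxAr.
  case: (boolP (occurs w t W)) => [oc|_]; last by rewrite !scale0r.
  rewrite split_output // -!mulmxA mulmxDl mulmx_suml mulmxA.
  by under [in RHS]eq_bigr do rewrite mulmxA.
under eq_fun do rewrite XU.
(* Only the summand [l = 0] survives in the limit. *)
have -> : markov f q0 v q *m C = sysC Sg q *m (Aword Sg (q0 :: v) *m 0 +
    \sum_(l < (size v).+1) G l *m (if l == ord0 then C else 0)).
  rewrite (markov_realization _ _ _ fS) mulmx0 add0r big_ord_recl /=.
  rewrite big1 ?addr0 => [|l _]; last by rewrite mulmx0.
  by rewrite /G drop0 -!mulmxA.
apply: cvg_mulmx; first exact: cvg_cst.
apply: cvgD.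
  by apply: cvg_mulmx; [exact: cvg_cst | exact: state_input_cvg0].
apply: cvg_sumr => l _; apply: cvg_mulmx; first exact: cvg_cst.
have [->|l0] := eqVneq l ord0.
  rewrite /U; under eq_fun => N do under eq_bigr => t do rewrite addn0.
  exact: WC.
have l_gt0 : (0 < l)%N by rewrite lt0n.
by have [+ _ _] := cross l (NEWord q0 (rcons v q)) l_gt0.
Qed.

Lemma markov_estimate_cvg (w : nat -> hinput R D m) (f : iomap R D m p)
    q0 v q : PE_condition w -> has_l1_stable_realization f ->
  markov_estimate (prefix_word w N) (outputs f (prefix_word w N))
    (q0 :: rcons v q) @[N --> \oo] --> markov f q0 v q.
Proof.
move=> PE [n [Sg [st fS]]]; have [Ru [pi_ [posRu pi_gt0 cross]]] := PE.
pose W := NEWord q0 (rcons v q); pose C := pi_ W *: Ru.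
have [_ _ WC] := cross 1%N W isT.
have uC : C \in unitmx.
  by rewrite unitmxZ ?unitfE ?gt_eqF //; exact: posdefmx_unit posRu.
(* The last [|v| + 1] times start windows that exceed the data, hence the shift
   from the number of data to the number of windows. *)
rewrite -(cvg_shiftn (size v).+1) /= -[markov _ _ _ _](mulmxK uC).
under eq_fun => N.
  rewrite markov_estimate_prefix size_rcons ?leq_addl // addnK.
  over.
by apply: cvg_mulmx; [exact: output_input_cvg PE st fS WC | exact: cvg_invmx].
Qed.

End Estimation.

Theorem theorem5 (R : realType) (D m p : nat)
    (hD : (0 < D)%N) (hm : (0 < m)%N) (hp : (0 < p)%N)
    (w : nat -> hinput R D m) (hw : PE_condition w) :
  exists Phi : nat -> seq 'I_D -> neword (hinput R D m) -> seq 'cV[R]_p ->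
               'M[R]_(\sum_(q < D) p, \sum_(q0 < D) m),
    forall f : iomap R D m p, has_l1_stable_realization f ->
    forall v : seq 'I_D,
      (fun N : nat => Phi N v (prefix_word w N) (outputs f (prefix_word w N)))
        @ \oo --> combined_markov f v.
Proof.
exists (fun _ v s ys =>
  \mxblock_(q < D, q0 < D) markov_estimate s ys (q0 :: rcons v q)).
move=> f fS v; apply/cvg_mxP => i j; rewrite mxE.
under eq_fun do rewrite mxE.
have /cvg_mxP := markov_estimate_cvg (q0 := tagnat.sig1 j) (v := v)
  (q := tagnat.sig1 i) hw fS.
exact.
Qed.
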